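(* Consider the multi-area interchange scheduling setting described in the context, and assume: (i) for every area $n$, every $q$ with $q\le Q$ and every realization $d_n$ of the net load, the second-stage problem $P_n(q_n,d_n)$ is feasible and is neither primal nor dual degenerate, and $\bar C(q)$ is finite for all $q\le Q$; (ii) every one-dimensional minimization in the update rule below has a minimizer (if there are several, any one is chosen). Let $q^{(0)}\in\mathbb{R}^I$ with $q^{(0)}\le Q$, and generate $\{q^{(k)}\}_{k\ge 0}$ by the cyclic update (synchronous interface-by-interface scheduling with zero tolerance): for $k=1,2,\dots$ and, within iteration $k$, successively for $i=1,2,\dots,I$, $$q^{(k)}(i)\in\arg\min_{x\le Q(i)} \bar C\big(q^{(k)}(1),\dots,q^{(k)}(i-1),\,x,\,q^{(k-1)}(i+1),\dots,q^{(k-1)}(I)\big).$$ Then every limit point $q^*$ of $\{q^{(k)}\}_{k\ge0}$ is an optimal solution of the first-stage problem $\min_{q\le Q}\bar C(q)$.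
   Context: There are $N$ independently operated areas and $I$ scheduling interfaces. Each interface $i\in\{1,\dots,I\}$ connects two distinct areas and carries a scalar flow $q(i)$ in a predetermined direction (from its origin area to its destination area); $q=(q(1),\dots,q(I))\in\mathbb{R}^I$ is the interchange vector and $Q\in\mathbb{R}^I$ the vector of interface capacities; $q\le Q$ is componentwise. For area $n$, $q_n$ is the vector of flows on the interfaces incident to area $n$, taken in the outbound direction: its entry for interface $i$ equals $q(i)$ if $n$ is the origin of interface $i$ and $-q(i)$ if $n$ is its destination. Area $n$ has a generation vector $g_n$, a random net load vector $d_n$ with distribution $\mathscr{F}_n$, a cost $C_n(g_n)=\tfrac12 g_n^\intercal H_n g_n+l_n^\intercal g_n$ with $H_n$ positive definite, a polyhedral set of generation constraints $\mathscr{G}_n$, a matrix $A_n$ of shift factors of internal buses to lines, a matrix $B_n$ of shift factors of the proxy buses to lines, and a vector $F_n$ of line capacities. The second-stage problem $P_n(q_n,d_n)$ is $$\min_{g_n\in\mathscr{G}_n} C_n(g_n)\ \text{ s.t. }\ \mathbf 1^\intercal(d_n-g_n)+\mathbf 1^\intercal q_n=0,\quad A_n(d_n-g_n)+B_nq_n\le F_n,$$ with optimal solution $g_n^*(q_n,d_n)$. The expected overall cost is $\bar C(q)=\sum_{n=1}^N\mathbb{E}_{d_n\sim\mathscr{F}_n}\big[C_n(g_n^*(q_n,d_n))\big]$, and the first-stage problem is $\min_{q\le Q}\bar C(q)$. *)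

(* Defs.v *)
From HB Require Import structures.
From mathcomp Require Import all_boot all_order all_algebra.
From mathcomp Require Import all_classical all_reals all_analysis.

Set Implicit Arguments.
Unset Strict Implicit.
Unset Printing Implicit Defensive.

Import Order.TTheory GRing.Theory Num.Theory.
Import numFieldNormedType.Exports.
Local Open Scope ring_scope.
Local Open Scope classical_set_scope.

Definition lecv {R : realType} {k : nat} (u v : 'cV[R]_k) : Prop :=
  forall j, u j 0 <= v j 0.

(* Data of the multi-area interchange scheduling problem.
   N areas (indexed by 'I_N), I interfaces (indexed by 'I_I).
   Area n has (m n) generation buses, (L n) internal lines,
   and its polyhedral generation set is G_n = {g | Egen n *m g <= egen n}
   with (K n) linear inequalities.  The net load of area n is the random
   vector dload n : T -> 'cV_(m n) on a common probability space. *)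
Record system (R : realType) (dT : measure_display) (T : measurableType dT)
    (N I : nat) := System {
  orig : 'I_I -> 'I_N;
  dest : 'I_I -> 'I_N;
  orig_dest : forall i, orig i != dest i;
  m : 'I_N -> nat;
  L : 'I_N -> nat;
  K : 'I_N -> nat;
  H : forall n, 'M[R]_(m n);
  lc : forall n, 'cV[R]_(m n);
  Egen : forall n, 'M[R]_(K n, m n);
  egen : forall n, 'cV[R]_(K n);
  A : forall n, 'M[R]_(L n, m n);      (* shift factors internal buses -> lines *)
  B : forall n, 'M[R]_(L n, I);        (* shift factors proxy buses -> lines;
                                          column i is only used when interface
                                          i is incident to area n *)
  F : forall n, 'cV[R]_(L n);          (* line capacities *)
  dload : forall n, T -> 'cV[R]_(m n)
}.

Section Defs.
Context {R : realType} {dT : measure_display} {T : measurableType dT} {N I : nat}.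
Variable S : system R T N I.

Definition posdef {k : nat} (M : 'M[R]_k) : Prop :=
  M^T = M /\ forall x : 'cV[R]_k, x != 0 -> 0 < (x^T *m M *m x) 0 0.

(* q_n : outbound flows on the interfaces incident to area n; entries of
   non-incident interfaces are 0 *)
Definition qarea (n : 'I_N) (q : 'cV[R]_I) : 'cV[R]_I :=
  \col_i (if orig S i == n then q i 0
          else if dest S i == n then - q i 0 else 0).

Definition cost (n : 'I_N) (g : 'cV[R]_(m S n)) : R :=
  2^-1 * (g^T *m H S n *m g) 0 0 + ((lc S n)^T *m g) 0 0.

Definition in_G (n : 'I_N) (g : 'cV[R]_(m S n)) : Prop :=
  lecv (Egen S n *m g) (egen S n).

Definition feasible (n : 'I_N) (qn : 'cV[R]_I) (d g : 'cV[R]_(m S n)) : Prop :=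
  in_G g /\
  \sum_j (d - g) j 0 + \sum_i qn i 0 = 0 /\
  lecv (A S n *m (d - g) + B S n *m qn) (F S n).

Definition optimal (n : 'I_N) (qn : 'cV[R]_I) (d g : 'cV[R]_(m S n)) : Prop :=
  feasible qn d g /\ forall g', feasible qn d g' -> cost g <= cost g'.

Definition gstar (n : 'I_N) (qn : 'cV[R]_I) (d : 'cV[R]_(m S n)) : 'cV[R]_(m S n) :=
  xget 0 (optimal qn d).

Definition active_line (n : 'I_N) (qn : 'cV[R]_I) (d g : 'cV[R]_(m S n))
  (j : 'I_(L S n)) : bool :=
  (A S n *m (d - g) + B S n *m qn) j 0 == F S n j 0.
Definition active_gen (n : 'I_N) (g : 'cV[R]_(m S n)) (k : 'I_(K S n)) : bool :=
  (Egen S n *m g) k 0 == egen S n k 0.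

(* primal nondegeneracy: the gradients (w.r.t. g) of the equality constraint
   and of all active inequality constraints are linearly independent *)
Definition primal_nondegenerate (n : 'I_N) (qn : 'cV[R]_I) (d g : 'cV[R]_(m S n))
  : Prop :=
  forall (lam : R) (mu : 'cV[R]_(L S n)) (nu : 'cV[R]_(K S n)),
    lam *: const_mx 1
    + (A S n)^T *m (\col_j (if active_line qn d g j then mu j 0 else 0))
    + (Egen S n)^T *m (\col_k (if active_gen g k then nu k 0 else 0)) = 0 ->
    lam = 0 /\ (forall j, active_line qn d g j -> mu j 0 = 0)
            /\ (forall k, active_gen g k -> nu k 0 = 0).

(* dual nondegeneracy: there are KKT multipliers at g satisfying strict
   complementarity (every active inequality has a positive multiplier) *)
Definition dual_nondegenerate (n : 'I_N) (qn : 'cV[R]_I) (d g : 'cV[R]_(m S n))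
  : Prop :=
  exists (lam : R) (mu : 'cV[R]_(L S n)) (nu : 'cV[R]_(K S n)),
    H S n *m g + lc S n - lam *: const_mx 1 - (A S n)^T *m mu + (Egen S n)^T *m nu = 0
    /\ (forall j, 0 <= mu j 0) /\ (forall k, 0 <= nu k 0)
    /\ (forall j, active_line qn d g j = (0 < mu j 0))
    /\ (forall k, active_gen g k = (0 < nu k 0)).

Definition stage2_cost (n : 'I_N) (q : 'cV[R]_I) (w : T) : R :=
  cost (gstar (qarea n q) (dload S n w)).

Definition Cbar (P : probability T R) (q : 'cV[R]_I) : R :=
  \sum_(n < N) fine (\int[P]_w (stage2_cost n q w)%:E)%E.

Definition mixvec (qk qk1 : 'cV[R]_I) (i : 'I_I) (x : R) : 'cV[R]_I :=
  \col_j (if (j < i)%N then qk j 0 else if j == i then x else qk1 j 0).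

Definition seq_limit_point (qs : nat -> 'cV[R]_I) (qstar : 'cV[R]_I) : Prop :=
  exists phi : nat -> nat, {homo phi : a b / (a < b)%N >-> (a < b)%N} /\
    forall i, (fun k => qs (phi k) i 0) @ \oo --> (qstar i 0 : R).

End Defs.

(* Main.v *)
Require Import Defs.
From HB Require Import structures.
From mathcomp Require Import all_boot all_order all_algebra.
From mathcomp Require Import all_classical all_reals all_analysis.
From mathcomp Require Import measurable_realfun ring lra.
Import Order.TTheory GRing.Theory Num.Theory.
Import numFieldNormedType.Exports.
Local Open Scope ring_scope.
Local Open Scope classical_set_scope.

Set Implicit Arguments.
Unset Strict Implicit.
Unset Printing Implicit Defensive.

(** Let [V w q] be the total second-stage cost for the realization [w], so that
    the objective is the expectation of [V]. At every [q <= Q] the KKT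
    multipliers give a subgradient of [V w], and linear independence of the
    active gradients gives a matching quadratic upper bound: [V w] is convex
    and differentiable on [q <= Q], with one-sided derivatives at the boundary.
    Moving a single flow changes the balance equation of its origin area, so
    positive definiteness of [H] makes [V w] strictly convex in each coordinate.
    The expectation is continuous on [q <= Q] by dominated convergence and
    strictly quasiconvex in each coordinate.

    Strict quasiconvexity forces the partial sweeps starting from a subsequence
    converging to [q*] to converge to [q*] as well, so [q*] minimizes the
    objective in each coordinate. To conclude, [V w q - V w q*] dominates the
    sum of the coordinatewise directional derivatives of [V w] at [q*], and the
    corresponding difference quotients have nonnegative expectation. *)

(** * Minimizers of positive definite quadratic functions *)

Lemma cvgr_sum (R : realType) (J : finType) (U : Type) (F : set_system U)
    {FF : Filter F} (f : J -> U -> R) (l : J -> R) :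
  (forall j, f j @ F --> l j) -> \sum_j f j x @[x --> F] --> \sum_j l j.
Proof. by move=> fl; apply: cvg_big => //; exact: add_continuous. Qed.

Lemma trmx_norm (R : realType) (k : nat) (x : 'cV[R]_k) : `|x^T| = `|x|.
Proof.
rewrite /Num.norm /= !mx_normrE; apply/le_anti/andP; split; apply/bigmax_leP;
  split => [|[i j] _]; rewrite ?mxE ?bigmax_ge_id //.
  by apply: (le_bigmax _ (fun ij : 'I_k * 'I_1 => `|x ij.1 ij.2|) (j, i)).
have := le_bigmax 0 (fun ij : 'I_1 * 'I_k => `|x^T ij.1 ij.2|) (j, i).
by rewrite /= mxE.
Qed.

Lemma continuous_linear_form (R : realType) (k l : nat) (M : 'M[R]_(k, l))
  (j : 'I_k) : continuous (fun v : 'rV[R]_l => (M *m v^T) j 0).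
Proof.
move=> v; under eq_fun do rewrite mxE.
apply: (@cvgr_sum _ _ _ _ (nbhs_filter v)) => i; under eq_fun do rewrite mxE.
by apply: cvgM; [exact: cvg_cst|rewrite mxE; exact: coord_continuous].
Qed.

Lemma continuous_quadratic_form (R : realType) (k : nat) (M : 'M[R]_k) :
  continuous (fun v : 'rV[R]_k => (v *m M *m v^T) 0 0).
Proof.
move=> v; under eq_fun do rewrite -mulmxA mxE.
apply: (@cvgr_sum _ _ _ _ (nbhs_filter v)) => i.
apply: cvgM; first exact: coord_continuous.
exact: continuous_linear_form.
Qed.

(** The form attains its minimum on the compact unit sphere, where it is positive, and homogeneity
    carries this bound to every vector. In dimension zero the sphere is empty and any positive
    constant works. *)
Lemma posdef_coercive (R : realType) (k : nat) (M : 'M[R]_k) : posdef M ->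
  exists2 c, 0 < c & forall x : 'cV[R]_k, c * `|x| ^+ 2 <= (x^T *m M *m x) 0 0.
Proof.
move=> [_ Mpos].
pose U := [set v : 'rV[R]_k | `|v| = 1].
have normalize (x : 'cV[R]_k) : x != 0 -> U (`|x|^-1 *: x^T).
  move=> x0; rewrite /U/= normrZ trmx_norm ger0_norm ?invr_ge0// mulVf//.
  by rewrite normr_eq0.
have [[v0 Uv0]|U0] := pselect (U !=set0); last first.
  exists 1 => // x; have [->|/normalize Ux] := eqVneq x 0.
    by rewrite normr0 expr0n mulr0 mulmx0 mxE.
  by case: U0; eexists; exact: Ux.
have Uc : compact U.
  apply: bounded_closed_compact.
    by exists 1; split => // r r1 v /= ->; exact: ltW.
  apply: (@preimage_closed _ _ (fun v : 'rV[R]_k => `|v|) [set 1]).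
    by move=> v _; exact: norm_continuous.
  exact: closed_eq.
have [||v Uv vmin] := 
  compact_EVT_min (f := fun v : 'rV[R]_k => (v *m M *m v^T) 0 0) _ Uc.
- by exists v0.
- exact/continuous_subspaceT/continuous_quadratic_form.
have v_neq0 : v != 0.
  apply/eqP => v0'; move: Uv; rewrite inE /U /= v0' normr0 => /esym/eqP.
  by rewrite oner_eq0.
exists ((v *m M *m v^T) 0 0).
  have /Mpos : v^T != 0 by rewrite -(inj_eq trmx_inj) trmxK trmx0.
  by rewrite trmxK.
move=> x; have [->|x0] := eqVneq x 0.
  by rewrite normr0 expr0n mulr0 mulmx0 mxE.
have x_gt0 : 0 < `|x| by rewrite normr_gt0.
have := vmin _ (mem_set (normalize x x0)).
rewrite linearZ /= trmxK -!scalemxAl -!scalemxAr !mxE mulrA.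
by rewrite -invfM mulrC ler_pdivlMr ?mulr_gt0// -expr2.
Qed.

Lemma le_linear_form (R : realType) (k : nat) (l x : 'cV[R]_k) :
  `|(l^T *m x) 0 0| <= (\sum_j `|l j 0|) * `|x|.
Proof.
rewrite mxE (le_trans (ler_norm_sum _ _ _))// mulr_suml ler_sum// => j _.
rewrite normrM mxE ler_wpM2l//.
rewrite [leRHS]/Num.norm /= mx_normrE.
exact: (le_bigmax _ (fun ij : 'I_k * 'I_1 => `|x ij.1 ij.2|) (j, 0)).
Qed.

(** Coercivity bounds the sublevel set of a feasible point [g0], so its intersection with the closed
    polyhedron is compact and [f] attains its minimum there. *)
Lemma exists_min_quadratic (R : realType) (k l : nat) (M : 'M[R]_k)
    (c : 'cV[R]_k) (E : 'M[R]_(l, k)) (e : 'cV[R]_l) : posdef M ->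
  (exists g, lecv (E *m g) e) ->
  let f (g : 'cV[R]_k) := 2^-1 * (g^T *m M *m g) 0 0 + (c^T *m g) 0 0 in
  exists2 g, lecv (E *m g) e & forall g', lecv (E *m g') e -> f g <= f g'.
Proof.
move=> /posdef_coercive[a a0 Ma] [g0 g0E] f.
pose C := \sum_j `|c j 0|.
have C0 : 0 <= C by exact: sumr_ge0.
have f_ge (g : 'cV[R]_k) : 2^-1 * (a * `|g| ^+ 2) - C * `|g| <= f g.
  apply: lerD; first by rewrite ler_pM2l// ?invr_gt0.
  by rewrite lerNl (le_trans _ (le_linear_form c g))// -normrN ler_norm.
(* [r] exceeds the positive root of [a/2 r^2 - C r = f g0]. *)
pose r := 2 * (C + 1 + `|f g0|) * (1 + a^-1).
have r0 : 0 <= r by rewrite !mulr_ge0 ?addr_ge0 ?invr_ge0// ltW.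
pose D := [set v : 'rV[R]_k | lecv (E *m v^T) e /\ f v^T <= f g0].
have f_cont : continuous (fun v : 'rV[R]_k => f v^T).
  move=> v; rewrite /f; under eq_fun do rewrite trmxK.
  apply: cvgD; [exact: (nbhs_filter v)| |exact: continuous_linear_form].
  apply: cvgMl_tmp; [exact: (nbhs_filter v)|exact: continuous_quadratic_form].
have Dc : compact D.
  apply: bounded_closed_compact.
    exists r; split=> [|s rs v /= [_ vg0]]; first exact: num_real.
    apply: (le_trans _ (ltW rs)); rewrite leNgt; apply/negP => rv.
    have := le_trans (f_ge v^T) vg0.
    rewrite -(trmx_norm v^T) trmxK; apply/negP; rewrite -ltNge.
    (* By the choice of [r], [2^-1 * a * r] is [(C + 1 + |f g0|) * (1 + a)]. Beyond [r] the lower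
       bound [f_ge] thus exceeds [(1 + |f g0|) * |v|], which contradicts [f v <= f g0] once
       [1 <= |v|]. *)
    have hv : (C + 1 + `|f g0|) < 2^-1 * a * `|v|.
      have ai : 0 < a^-1 by rewrite invr_gt0.
      have cancel (b X : R) : b != 0 ->
          2^-1 * b * (2 * X * (1 + b^-1)) = X * (1 + b) by move=> b0; field.
      have := cancel a (C + 1 + `|f g0|) (lt0r_neq0 a0).
      rewrite -/r.
      have := normr_ge0 (f g0) => h1 h2.
      have : 2^-1 * a * r < 2^-1 * a * `|v| by rewrite ltr_pM2l// mulr_gt0 ?invr_gt0.
      by rewrite h2; nra.
    have v1 : 1 <= `|v|.
      apply: le_trans (ltW rv); rewrite /r.
      have ai : 0 < a^-1 by rewrite invr_gt0.
      have := normr_ge0 (f g0); nra.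
    have := ler_norm (f g0); have := normr_ge0 (f g0); nra.
  rewrite [D](_ : _ =
      (\bigcap_(j in [set: 'I_l]) [set v : 'rV[R]_k | (E *m v^T) j 0 <= e j 0])
      `&` [set v : 'rV[R]_k | f v^T <= f g0]); last first.
    apply/seteqP; split => v /= [Ev fv]; split => //.
      by move=> j _; exact: Ev.
    by move=> j; exact: Ev.
  apply: closedI.
    apply: closed_bigI => j _.
    apply: (@preimage_closed _ _ (fun v : 'rV[R]_k => (E *m v^T) j 0)
      [set x | x <= e j 0]).
      by move=> v _; exact: continuous_linear_form.
    exact: closed_le.
  apply: (@preimage_closed _ _ (fun v : 'rV[R]_k => f v^T) [set x | x <= f g0]).
    by move=> v _; exact: f_cont.
  exact: closed_le.
have [||v Dv vmin] := compact_EVT_min (f := fun v : 'rV[R]_k => f v^T) _ Dc.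
- by exists g0^T; rewrite /D /= trmxK.
- exact/continuous_subspaceT.
move: Dv; rewrite inE => -[Ev fv]; exists v^T => // g Eg.
have [gg0|/ltW/(le_trans fv)//] := leP (f g) (f g0).
by have := vmin g^T; rewrite trmxK; apply; rewrite inE /D/= trmxK.
Qed.

(** * Sensitivity of the second-stage problem *)

Lemma lecv_col_mx (R : realType) (k l : nat) (u u' : 'cV[R]_k)
    (v v' : 'cV[R]_l) :
  lecv (col_mx u v) (col_mx u' v') <-> lecv u u' /\ lecv v v'.
Proof.
split=> [uv|[uu' vv'] j]; last first.
  rewrite -(fintype.splitK j); case: (fintype.split j) => i /=.
    by rewrite !col_mxEu.
  by rewrite !col_mxEd.
by split=> i; [have := uv (lshift _ i); rewrite !col_mxEu
              |have := uv (rshift _ i); rewrite !col_mxEd].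
Qed.

Lemma mx_addE (R : realType) (k l : nat) (M M' : 'M[R]_(k, l)) i j :
  (M + M') i j = M i j + M' i j.
Proof. by rewrite mxE. Qed.

Lemma mx_oppE (R : realType) (k l : nat) (M : 'M[R]_(k, l)) i j :
  (- M) i j = - M i j.
Proof. by rewrite mxE. Qed.

Lemma mulmx_ones (R : realType) (k : nat) (u : 'cV[R]_k) (i j : 'I_1) :
  ((const_mx 1 : 'rV[R]_k) *m u) i j = \sum_l u l 0.
Proof. by rewrite mxE; apply: eq_bigr => l _; rewrite mxE mul1r (ord1 j). Qed.

Lemma le_mulmx_entry (R : realType) (k l : nat) (M : 'M[R]_(k, l))
    (h : 'cV[R]_l) (e : R) (j : 'I_k) :
  (forall i, `|h i 0| <= e) -> `|(M *m h) j 0| <= e * \sum_i `|M j i|.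
Proof.
move=> he; rewrite mxE (le_trans (ler_norm_sum _ _ _))// mulr_sumr ler_sum//.
by move=> i _; rewrite normrM mulrC ler_wpM2r.
Qed.

Lemma le_quadratic_form (R : realType) (k : nat) (M : 'M[R]_k)
    (h : 'cV[R]_k) (e : R) : 0 <= e -> (forall i, `|h i 0| <= e) ->
  (h^T *m M *m h) 0 0 <= (\sum_i \sum_j `|M i j|) * e ^+ 2.
Proof.
move=> e0 he; rewrite -mulmxA mxE mulr_suml ler_sum// => i _.
rewrite (le_trans (ler_norm _))// normrM mxE.
have -> : (\sum_j `|M i j|) * e ^+ 2 = e * (e * \sum_j `|M i j|) by ring.
by apply: ler_pM => //; exact: le_mulmx_entry.
Qed.

Lemma near_mul_lt (R : realType) (a b : R) : 0 < b ->
  \forall e \near 0^'+, e * a < b.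
Proof.
move=> b0; near=> e.
have e0 : 0 < e by near: e; exact: nbhs_right_gt.
have : e < b / (`|a| + 1).
  by near: e; apply: nbhs_right_lt; rewrite divr_gt0// ltr_wpDl.
rewrite ltr_pdivlMr ?ltr_wpDl//; apply: le_lt_trans.
by rewrite ler_pM2l// (le_trans (ler_norm a))// lerDl.
Unshelve. all: by end_near. Qed.

Section Area.
Context {R : realType} {dT : measure_display} {T : measurableType dT} {N I : nat}.
Variable S : system R T N I.
Implicit Types (n : 'I_N) (p q : 'cV[R]_I).

(** The balance equation splits into two opposite inequalities, which gives the form required by
    [exists_min_quadratic]. *)
Lemma feasible_polyhedron n (qn : 'cV[R]_I) (d : 'cV[R]_(m S n)) :
  exists l (E : 'M[R]_(l, m S n)) (e : 'cV[R]_l),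
  forall g, feasible qn d g <-> lecv (E *m g) e.
Proof.
pose ones : 'rV[R]_(m S n) := const_mx 1.
pose b : 'cV[R]_1 := const_mx (\sum_j d j 0 + \sum_i qn i 0).
exists _, (col_mx (Egen S n) (col_mx ones (col_mx (- ones) (- A S n)))),
  (col_mx (egen S n) (col_mx b (col_mx (- b) (F S n - A S n *m d - B S n *m qn)))).
move=> g; rewrite !mul_col_mx !lecv_col_mx.
have sumE : \sum_j (d - g) j 0 = \sum_j d j 0 - \sum_j g j 0.
  by rewrite -sumrB; apply: eq_bigr => j _; rewrite !mxE.
split=> [[inG [bal cap]]|[inG [bal1 [bal2 cap]]]].
- split=> //; split=> [j|]; last split=> j.
  + by rewrite mulmx_ones mxE; lra.
  + rewrite mulNmx [leLHS]mxE mulmx_ones !mxE; lra.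
  + have := cap j; rewrite mulmxBr mulNmx !mxE; lra.
- split=> //; split=> [|j].
    have := bal1 0; have := bal2 0.
    rewrite mulNmx [X in X <= _ -> _]mxE mulmx_ones !mxE sumE; lra.
  have := cap j; rewrite mulmxBr mulNmx !mxE; lra.
Qed.

Lemma gstar_optimal n (qn : 'cV[R]_I) (d : 'cV[R]_(m S n)) :
  posdef (H S n) -> (exists g, feasible qn d g) -> optimal qn d (gstar qn d).
Proof.
move=> Hpos [g0 g0F]; apply: (xgetPex 0).
have [l [E [e feasE]]] := feasible_polyhedron qn d.
have [|g /feasE gF gmin] := @exists_min_quadratic _ _ _ _ (lc S n) E e Hpos.
  by exists g0; exact/feasE.
by exists g; split => // g' /feasE; exact: gmin.
Qed.

(** An empty system of inequalities makes the minimum unconstrained. The bound is therefore the same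
    for all realizations and interchanges. *)
Lemma cost_lower_bound n : posdef (H S n) ->
  exists c, forall g : 'cV[R]_(m S n), c <= cost g.
Proof.
move=> Hpos.
have [|g _ gmin] := @exists_min_quadratic _ _ 0 _ (lc S n) 0 0 Hpos.
  by exists 0 => -[].
by exists (cost g) => g'; apply: gmin => -[].
Qed.

Lemma cost_expansion n (g h : 'cV[R]_(m S n)) : (H S n)^T = H S n ->
  cost (g + h) = cost g + ((H S n *m g + lc S n)^T *m h) 0 0
               + 2^-1 * (h^T *m H S n *m h) 0 0.
Proof.
move=> Hsym; rewrite /cost.
have hHg : (h^T *m H S n *m g) 0 0 = (g^T *m H S n *m h) 0 0.
  rewrite -[LHS](mxE trmx_key (fun i j => (h^T *m H S n *m g) j i)) -/(trmx _).
  by rewrite !trmx_mul trmxK Hsym mulmxA.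
rewrite !(linearD, mulmxDl, mulmxDr)/= trmx_mul Hsym !mulmxDl.
move: hHg; rewrite !mx_addE.
set a := (h^T *m _ *m g) 0 0; set b := (g^T *m _ *m h) 0 0 => ->.
by field.
Qed.

(* The multipliers [lam], [mu] price the right-hand sides of the balance and
   line constraints, so the value function has slope [lam + B^T mu]. *)
Definition price n (lam : R) (mu : 'cV[R]_(L S n)) : 'cV[R]_I :=
  \col_i (lam + ((B S n)^T *m mu) i 0).

Lemma dot_price n lam (mu : 'cV[R]_(L S n)) (h : 'cV[R]_I) :
  \sum_i price lam mu i 0 * h i 0 =
  lam * \sum_i h i 0 + \sum_j mu j 0 * (B S n *m h) j 0.
Proof.
rewrite mulr_sumr.
have -> : \sum_j mu j 0 * (B S n *m h) j 0 = \sum_i ((B S n)^T *m mu) i 0 * h i 0.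
  under eq_bigr do rewrite mxE mulr_sumr.
  rewrite exchange_big; apply: eq_bigr => i _ /=.
  rewrite mxE mulr_suml; apply: eq_bigr => j _; rewrite mxE; ring.
by rewrite -big_split; apply: eq_bigr => i _; rewrite mxE mulrDl.
Qed.

(** Stationarity trades the gradient of the cost for multipliers, so that its first-order change
    depends only on the changes in the constraint values. *)
Lemma dot_gradient n (g h : 'cV[R]_(m S n)) lam (mu : 'cV[R]_(L S n))
    (nu : 'cV[R]_(K S n)) :
  H S n *m g + lc S n - lam *: const_mx 1 - (A S n)^T *m mu
    + (Egen S n)^T *m nu = 0 ->
  ((H S n *m g + lc S n)^T *m h) 0 0 =
  lam * \sum_j h j 0 + \sum_j mu j 0 * (A S n *m h) j 0
  - \sum_k nu k 0 * (Egen S n *m h) k 0.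
Proof.
move=> stat.
have -> : H S n *m g + lc S n =
    lam *: const_mx 1 + (A S n)^T *m mu - (Egen S n)^T *m nu.
  by apply/eqP; rewrite -subr_eq0 -stat !opprD opprK !addrA.
rewrite !(linearD, linearN, linearZ)/= !trmx_mul !trmxK trmx_const !mulmxDl mulNmx.
rewrite -scalemxAl -!mulmxA !mx_addE mx_oppE.
rewrite [X in X + _ - _ = _]mxE mulmx_ones; congr (_ + _ - _).
  by rewrite mxE; apply: eq_bigr => j _; rewrite mxE.
by rewrite mxE; apply: eq_bigr => j _; rewrite mxE.
Qed.

Lemma feasible_sum n (pn : 'cV[R]_I) (d g : 'cV[R]_(m S n)) :
  feasible pn d g -> \sum_j g j 0 = \sum_j d j 0 + \sum_i pn i 0.
Proof.
move=> [_ [+ _]].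
have -> : \sum_j (d - g) j 0 = \sum_j d j 0 - \sum_j g j 0.
  by rewrite -sumrB; apply: eq_bigr => j _; rewrite !mxE.
lra.
Qed.

(** * Bounds on the cost from KKT multipliers *)

Section KKT.
Variables (n : 'I_N) (qn : 'cV[R]_I) (d g : 'cV[R]_(m S n)).
Hypothesis Hsym : (H S n)^T = H S n.
Hypothesis gF : feasible qn d g.
Variables (lam : R) (mu : 'cV[R]_(L S n)) (nu : 'cV[R]_(K S n)).
Hypothesis stat : H S n *m g + lc S n - lam *: const_mx 1 - (A S n)^T *m mu
  + (Egen S n)^T *m nu = 0.
Hypothesis mu_ge0 : forall j, 0 <= mu j 0.
Hypothesis nu_ge0 : forall k, 0 <= nu k 0.
Hypothesis mu_active : forall j, active_line qn d g j = (0 < mu j 0).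
Hypothesis nu_active : forall k, active_gen g k = (0 < nu k 0).

(** By complementarity a positive multiplier sits on a constraint that is tight at [g], and [g']
    satisfies its perturbed version, which fixes the sign of each term. The quadratic remainder is
    kept because it later gives strictness. *)
Lemma cost_ge_tangent (pn : 'cV[R]_I) (g' : 'cV[R]_(m S n)) :
  feasible pn d g' ->
  cost g + \sum_i price lam mu i 0 * (pn - qn) i 0
    + 2^-1 * ((g' - g)^T *m H S n *m (g' - g)) 0 0 <= cost g'.
Proof.
move=> g'F; have [inG' [_ cap']] := g'F.
rewrite -[X in _ <= cost X](subrKC g) cost_expansion// lerD2r lerD2l.
rewrite (dot_gradient _ stat) dot_price.
have -> : \sum_j (g' - g) j 0 = \sum_i (pn - qn) i 0.
  under eq_bigr do rewrite mx_addE mx_oppE.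
  under [RHS]eq_bigr do rewrite mx_addE mx_oppE.
  by rewrite !sumrB (feasible_sum gF) (feasible_sum g'F); ring.
suff : \sum_j mu j 0 * (B S n *m (pn - qn)) j 0 <=
         \sum_j mu j 0 * (A S n *m (g' - g)) j 0 /\
       \sum_k nu k 0 * (Egen S n *m (g' - g)) k 0 <= 0 by lra.
split.
  apply: ler_sum => j _; have := mu_ge0 j; rewrite le_eqVlt => /predU1P[<-|mu0].
    by rewrite !mul0r.
  rewrite ler_pM2l//; have := cap' j; move: mu0; rewrite -mu_active => /eqP <-.
  by rewrite !mulmxBr !mxE; lra.
apply: sumr_le0 => k _; have := nu_ge0 k; rewrite le_eqVlt => /predU1P[<-|nu0].
  by rewrite mul0r.
rewrite pmulr_rle0//; have := inG' k; move: nu0; rewrite -nu_active => /eqP <-.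
by rewrite mulmxBr !mxE; lra.
Qed.

(** A move that follows the active constraints turns the inequalities of [cost_ge_tangent] into
    equalities, since all other multipliers vanish. The slope is therefore the same, with a
    remainder quadratic in [h]. *)
Lemma cost_tangent (G : 'M[R]_(m S n, I)) (h : 'cV[R]_I) :
  \sum_j (G *m h) j 0 = \sum_i h i 0 ->
  (forall j, active_line qn d g j -> (A S n *m (G *m h)) j 0 = (B S n *m h) j 0) ->
  (forall k, active_gen g k -> (Egen S n *m (G *m h)) k 0 = 0) ->
  cost (g + G *m h) = cost g + \sum_i price lam mu i 0 * h i 0
    + 2^-1 * (h^T *m (G^T *m H S n *m G) *m h) 0 0.
Proof.
move=> Gsum GA GE; rewrite cost_expansion// (dot_gradient _ stat) dot_price Gsum.
rewrite trmx_mul !mulmxA; congr (_ + _ + _).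
rewrite [X in _ - X]big1 => [|k _]; last first.
  have := nu_ge0 k; rewrite le_eqVlt => /predU1P[<-|nu0]; first by rewrite mul0r.
  by rewrite -mulmxA GE ?mulr0// nu_active.
rewrite subr0; congr (_ + _); apply: eq_bigr => j _.
have := mu_ge0 j; rewrite le_eqVlt => /predU1P[<-|mu0]; first by rewrite !mul0r.
by rewrite -mulmxA GA// mu_active.
Qed.

End KKT.

(* Linear independence of the active gradients makes the active constraints
   solvable for every right-hand side (Fredholm alternative). *)
Lemma primal_nondegenerate_solve n (qn : 'cV[R]_I) (d g : 'cV[R]_(m S n)) :
  primal_nondegenerate qn d g ->
  exists G : 'M[R]_(m S n, I), forall h : 'cV[R]_I,
  [/\ \sum_j (G *m h) j 0 = \sum_i h i 0,
      forall j, active_line qn d g j -> (A S n *m (G *m h)) j 0 = (B S n *m h) j 0 &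
      forall k, active_gen g k -> (Egen S n *m (G *m h)) k 0 = 0].
Proof.
move=> licq.
(* The diagonal masks [a] and [b] erase the inactive constraints, so that one linear system encodes
   exactly the active ones. *)
pose a := diag_mx (\row_j (active_line qn d g j)%:R) : 'M[R]_(L S n).
pose b := diag_mx (\row_k (active_gen g k)%:R) : 'M[R]_(K S n).
have aE k (u : 'M[R]_(_, k)) j i :
    (a *m u) j i = if active_line qn d g j then u j i else 0.
  by rewrite mul_diag_mx !mxE; case: ifP => _; rewrite ?mul1r ?mul0r.
have bE k (u : 'M[R]_(_, k)) j i :
    (b *m u) j i = if active_gen g j then u j i else 0.
  by rewrite mul_diag_mx !mxE; case: ifP => _; rewrite ?mul1r ?mul0r.
pose C := row_mx (const_mx 1 : 'cV[R]_(m S n))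
  (row_mx ((A S n)^T *m a) ((Egen S n)^T *m b)).
pose D := row_mx (const_mx 1 : 'cV[R]_I)
  (row_mx ((B S n)^T *m a) (0 : 'M[R]_(I, K S n))).
(* A factorization of [D] through [C] exists as soon as [D] kills the kernel of [C]. On that kernel
   linear independence annihilates [lam] and the active part of [mu], which are all that [D]
   sees. *)
have : (D <= C)%MS.
  rewrite submxE; apply/eqP/matrixP => i j.
  have Cy : C *m col j (cokermx C) = 0 by rewrite colE mulmxA mulmx_coker mul0mx.
  have -> : (D *m cokermx C) i j = (D *m col j (cokermx C)) i 0.
    have -> : D *m col j (cokermx C) = col j (D *m cokermx C).
      by rewrite !colE mulmxA.
    by rewrite [RHS]mxE.
  move: Cy; set y := col j _.
  rewrite -(vsubmxK y) -(vsubmxK (dsubmx y)) !mul_row_col.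
  set lam := usubmx y; set mu := usubmx _; set nu := dsubmx _.
  have -> : (const_mx 1 : 'cV[R]_(m S n)) *m lam = lam 0 0 *: const_mx 1.
    by apply/matrixP => x z; rewrite mxE big_ord1 !mxE !ord1 mulrC.
  rewrite -!mulmxA addrA.
  have -> : a *m mu = \col_j (if active_line qn d g j then mu j 0 else 0).
    by apply/matrixP => x z; rewrite (ord1 z) aE [RHS]mxE.
  have -> : b *m nu = \col_k (if active_gen g k then nu k 0 else 0).
    by apply/matrixP => x z; rewrite (ord1 z) bE [RHS]mxE.
  move=> /licq[lam0 [mu0 _]].
  have -> : lam = 0 by apply/matrixP => x z; rewrite !ord1 lam0 mxE.
  have -> : \col_j (if active_line qn d g j then mu j 0 else 0) = 0 :> 'cV[R]_(L S n).
    by apply/matrixP => x z; rewrite [LHS]mxE [RHS]mxE; case: ifP => // /mu0.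
  by rewrite mulmx0 add0r mulmx0 mul0mx addr0 !mxE.
move=> /submxP[G' DE]; exists G'^T => h.
have {DE} : D^T *m h = C^T *m (G'^T *m h) by rewrite DE trmx_mul mulmxA.
rewrite !tr_row_mx !trmx_mul !trmxK trmx0 !mul_col_mx.
move=> /eq_col_mx[E1 /eq_col_mx[E2 E3]].
have aT : a^T = a by rewrite tr_diag_mx.
have bT : b^T = b by rewrite tr_diag_mx.
split.
- by move/matrixP/(_ 0 0): E1; rewrite !trmx_const !mulmx_ones.
- move=> j aj; move/matrixP/(_ j 0): E2.
  by rewrite aT -!mulmxA !aE aj.
- move=> k bk; move/matrixP/(_ k 0): E3.
  by rewrite bT mul0mx -!mulmxA bE bk mxE.
Qed.

(** Active constraints stay tight along [G *m h], and each inactive one has a positive slack that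
    absorbs a change of order [e]. There are finitely many constraints, so one range of [e] serves
    them all. *)
Lemma feasible_near n (qn : 'cV[R]_I) (d g : 'cV[R]_(m S n)) (G : 'M[R]_(m S n, I)) :
  feasible qn d g ->
  (forall h : 'cV[R]_I,
  [/\ \sum_j (G *m h) j 0 = \sum_i h i 0,
      forall j, active_line qn d g j -> (A S n *m (G *m h)) j 0 = (B S n *m h) j 0 &
      forall k, active_gen g k -> (Egen S n *m (G *m h)) k 0 = 0]) ->
  \forall e \near 0^'+, forall h : 'cV[R]_I, (forall i, `|h i 0| <= e) ->
    feasible (qn + h) d (g + G *m h).
Proof.
move=> [inG [bal cap]] Gh.
have gen_near : \forall e \near 0^'+, forall k (h : 'cV[R]_I),
    (forall i, `|h i 0| <= e) -> (Egen S n *m (g + G *m h)) k 0 <= egen S n k 0.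
  apply: filter_forall => k; have := inG k.
  have [/eqP gk _|gk] := boolP (active_gen g k).
    apply: nearW => e h _; have [_ _ /(_ k)] := Gh h.
    by rewrite mulmxDr mx_addE gk => ->; rewrite ?addr0//; exact/eqP.
  rewrite le_eqVlt -[_ == _]/(active_gen g k) (negPf gk) /= -subr_gt0 => slack.
  near=> e => h he.
  have := le_mulmx_entry (Egen S n *m G) k he.
  rewrite -mulmxA ler_norml => /andP[_ h1].
  rewrite mulmxDr mx_addE -lerBrDl (le_trans h1)// ltW//.
  near: e; exact: near_mul_lt.
have line_near : \forall e \near 0^'+, forall j (h : 'cV[R]_I),
    (forall i, `|h i 0| <= e) ->
    (A S n *m (d - (g + G *m h)) + B S n *m (qn + h)) j 0 <= F S n j 0.
  apply: filter_forall => j; have := cap j.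
  have E (h : 'cV[R]_I) : (A S n *m (d - (g + G *m h)) + B S n *m (qn + h)) j 0 =
      (A S n *m (d - g) + B S n *m qn) j 0 + ((B S n - A S n *m G) *m h) j 0.
    by rewrite opprD addrA !mulmxDr !mulmxN mulmxDl mulNmx -mulmxA !mxE; ring.
  have [/eqP gk _|gk] := boolP (active_line qn d g j).
    apply: nearW => e h _; have [_ /(_ j) + _] := Gh h.
    rewrite E gk mulmxBl -mulmxA => hj; rewrite mx_addE mx_oppE hj ?subrr ?addr0//.
    exact/eqP.
  rewrite le_eqVlt -[_ == _]/(active_line qn d g j) (negPf gk) /= -subr_gt0 => slack.
  near=> e => h he.
  have := le_mulmx_entry (B S n - A S n *m G) j he.
  rewrite ler_norml => /andP[_ h1].
  rewrite E -lerBrDl (le_trans h1)// ltW//.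
  near: e; exact: near_mul_lt.
near=> e => h he; split; last split.
- by move=> k; move: k h he; near: e; exact: gen_near.
- have [Gsum _ _] := Gh h; rewrite opprD addrA.
  under eq_bigr do rewrite mx_addE mx_oppE.
  under [X in _ + X = 0]eq_bigr do rewrite mx_addE.
  by rewrite sumrB big_split/= Gsum addrACA bal; ring.
- by move=> j; move: j h he; near: e; exact: line_near.
Unshelve. all: by end_near. Qed.

End Area.

(** * Coordinate descent *)

Definition upd {R : realType} {I : nat} (z : 'cV[R]_I) (i : 'I_I) (x : R) :
  'cV[R]_I := \col_j (if j == i then x else z j 0).

Section Descent.
Context {R : realType} {I : nat}.
Implicit Types (p q z : 'cV[R]_I) (i : 'I_I).

Lemma updE z i x : upd z i x i 0 = x.
Proof. by rewrite mxE eqxx. Qed.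

Lemma updNE z i x j : j != i -> upd z i x j 0 = z j 0.
Proof. by move=> ji; rewrite mxE (negPf ji). Qed.

Lemma upd_id z i : upd z i (z i 0) = z.
Proof. by apply/matrixP => j k; rewrite mxE (ord1 k); case: eqP => [->|]. Qed.

Lemma upd_upd z i x y : upd (upd z i x) i y = upd z i y.
Proof. by apply/matrixP => j k; rewrite !mxE; case: (j == i). Qed.

Lemma lecv_upd Q z i x : lecv z Q -> x <= Q i 0 -> lecv (upd z i x) Q.
Proof. by move=> zQ xQ j; rewrite mxE; case: eqP => [->|]. Qed.

Section Convergence.
Variables (Q : 'cV[R]_I) (f : 'cV[R]_I -> R) (qs : nat -> 'cV[R]_I).
Hypothesis f_cont : forall (p : nat -> 'cV[R]_I) q,
  (forall k, lecv (p k) Q) -> lecv q Q ->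
  (forall i, (fun k => p k i 0) @ \oo --> q i 0) ->
  (fun k => f (p k)) @ \oo --> f q.
Hypothesis f_strict : forall z i x c y, lecv z Q -> x < c -> c < y -> y <= Q i 0 ->
  f (upd z i c) < Num.max (f (upd z i x)) (f (upd z i y)).
Hypothesis qsQ : forall k, lecv (qs k) Q.
Hypothesis qs_min : forall k i x, x <= Q i 0 ->
  f (mixvec (qs k.+1) (qs k) i (qs k.+1 i 0)) <= f (mixvec (qs k.+1) (qs k) i x).

(** The position is a natural number so that it can reach [I]: the sweep runs from [qs k] to
    [qs k.+1], one coordinate update per step. *)
Let sweep k (i : nat) : 'cV[R]_I :=
  \col_j (if (j < i)%N then qs k.+1 j 0 else qs k j 0).

Let sweepQ k (i : nat) : lecv (sweep k i) Q.
Proof. by move=> j; rewrite mxE; case: ifP => _; exact: qsQ. Qed.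

Let sweep0 k : sweep k 0 = qs k.
Proof. by apply/matrixP => j l; rewrite mxE (ord1 l). Qed.

Let sweepI k : sweep k I = qs k.+1.
Proof. by apply/matrixP => j l; rewrite mxE (ord1 l) ltn_ord. Qed.

Let mixvec_sweep k i x : mixvec (qs k.+1) (qs k) i x = upd (sweep k i) i x.
Proof.
apply/matrixP => j l; rewrite !mxE; have [->|//] := eqVneq j i.
by rewrite ltnn.
Qed.

Let sweepS k i : sweep k i.+1 = upd (sweep k i) i (qs k.+1 i 0).
Proof.
apply/matrixP => j l; rewrite !mxE ltnS leq_eqVlt.
by have [->|ji] := eqVneq j i; rewrite ?eqxx//= (inj_eq val_inj) (negPf ji).
Qed.

Let sweep_id k i : sweep k i = upd (sweep k i) i (qs k i 0).
Proof. by rewrite -{1}[sweep k i](upd_id _ i) mxE ltnn. Qed.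

Let sweep_min k i x : x <= Q i 0 -> f (sweep k i.+1) <= f (upd (sweep k i) i x).
Proof. by move=> xQ; rewrite sweepS -!mixvec_sweep; exact: qs_min. Qed.

Let sweep_noninc k (i : nat) : (i < I)%N -> f (sweep k i.+1) <= f (sweep k i).
Proof.
move=> iI; have := @sweep_min k (Ordinal iI) (qs k (Ordinal iI) 0) (qsQ _ _).
by rewrite -sweep_id.
Qed.

Let sweep_le_start k (i : nat) : (i <= I)%N -> f (sweep k i) <= f (qs k).
Proof.
elim: i => [|i IH] iI; first by rewrite sweep0.
exact: le_trans (sweep_noninc _ iI) (IH (ltnW iI)).
Qed.

Let sweep_ge_end k (i : nat) : (i <= I)%N -> f (qs k.+1) <= f (sweep k i).
Proof.
move=> iI; rewrite -sweepI.
have : forall l, (i + l <= I)%N -> f (sweep k (i + l)) <= f (sweep k i).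
  elim=> [|l IH]; first by rewrite addn0.
  rewrite addnS => lI; exact: le_trans (sweep_noninc _ lI) (IH (ltnW lI)).
by move=> /(_ (I - i)%N); rewrite subnKC//; exact.
Qed.

Let qs_noninc k l : (k <= l)%N -> f (qs l) <= f (qs k).
Proof.
move=> /subnKC <-; elim: (l - k)%N => [|j IH]; first by rewrite addn0.
by rewrite addnS (le_trans _ IH)// -[X in _ <= f X]sweep0; exact: sweep_ge_end.
Qed.

Lemma coordinate_descent_limit qbar : seq_limit_point qs qbar ->
  lecv qbar Q /\ forall i x, x <= Q i 0 -> f qbar <= f (upd qbar i x).
Proof.
move=> [phi [phi_incr phi_cvg]].
have qbarQ : lecv qbar Q.
  move=> i; apply: (ler_cvg_to (phi_cvg i) (cvg_cst (Q i 0))).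
  by apply: nearW => k; exact: qsQ.
split => //.
have qs_cvg : (fun k => f (qs (phi k))) @ \oo --> f qbar by exact: f_cont.
(* The values never increase and [(phi k).+1 <= phi k.+1], so those of the partial sweeps are
   squeezed between two consecutive terms of the convergent subsequence. *)
have sweep_fcvg (i : nat) : (i <= I)%N ->
    (fun k => f (sweep (phi k) i)) @ \oo --> f qbar.
  move=> iI.
  apply: (@squeeze_cvgr _ _ _ _ (fun k => f (qs (phi k.+1)))
    (fun k => f (qs (phi k)))).
  - apply: nearW => k; apply/andP; split; last exact: sweep_le_start.
    apply: le_trans (sweep_ge_end _ iI); apply: qs_noninc.
    exact: phi_incr.
  - by rewrite (cvg_shiftS (fun k => f (qs (phi k)))).
  - exact: qs_cvg.
have upd_cvg i x : (forall j, (fun k => sweep (phi k) i j 0) @ \oo --> qbar j 0) ->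
    x <= Q i 0 ->
    (fun k => f (upd (sweep (phi k) i) i x)) @ \oo --> f (upd qbar i x).
  move=> zcvg xQ; apply: f_cont; [by move=> k; exact: lecv_upd|exact: lecv_upd|].
  move=> j; under eq_fun do rewrite mxE; rewrite mxE.
  by case: ifP => _; [exact: cvg_cst|exact: zcvg].
have coord_min i x : (forall j, (fun k => sweep (phi k) i j 0) @ \oo --> qbar j 0) ->
    x <= Q i 0 -> f qbar <= f (upd qbar i x).
  move=> zcvg xQ.
  apply: (ler_cvg_to (sweep_fcvg i.+1 (ltn_ord i)) (upd_cvg i x zcvg xQ)).
  by apply: nearW => k; exact: sweep_min.
(* If [x] did no worse than [qbar], strictness would push the midpoint [y] below [f qbar], against
   [coord_min]. *)
have coord_lt i x : (forall j, (fun k => sweep (phi k) i j 0) @ \oo --> qbar j 0) ->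
    x <= Q i 0 -> x != qbar i 0 -> f qbar < f (upd qbar i x).
  move=> zcvg xQ xq; pose y := (x + qbar i 0) / 2.
  have qQ := qbarQ i.
  have : f (upd qbar i y) < Num.max (f (upd qbar i x)) (f qbar).
    case: (ltgtP x (qbar i 0)) xq => // xq _.
      rewrite -{3}(upd_id qbar i); apply: f_strict => //; rewrite /y; lra.
    rewrite maxC -{2}(upd_id qbar i); apply: f_strict => //; rewrite /y; lra.
  rewrite lt_max => /orP[|]; last by rewrite ltNge coord_min// /y; lra.
  by apply: le_lt_trans; apply: coord_min => //; rewrite /y; lra.
have sweep_cvg (i : nat) : (i <= I)%N ->
    forall j, (fun k => sweep (phi k) i j 0) @ \oo --> qbar j 0.
  elim: i => [_ j|i IH iI j]; first by under eq_fun do rewrite sweep0; exact: phi_cvg.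
  have {}IH := IH (ltnW iI); pose oi := Ordinal iI.
  have zE k : sweep (phi k) i.+1 = upd (sweep (phi k) oi) oi (qs (phi k).+1 oi 0).
    exact: (sweepS (phi k) oi).
  under eq_fun do rewrite zE mxE.
  have [->|_] := eqVneq j oi; last exact: IH.
  have xcvg : (fun k => qs (phi k) oi 0) @ \oo --> qbar oi 0 by exact: phi_cvg.
  (* A level [c] that separates the old and new values of coordinate [i]
     cannot persist: [f] at that level would not exceed its old value. *)
  have separated c : c <= Q oi 0 -> c != qbar oi 0 ->
      \forall k \near \oo, f (sweep (phi k) i) < f (upd (sweep (phi k) oi) oi c).
    move=> cQ cq; have fc := coord_lt oi c IH cQ cq.
    have d0 : 0 < f (upd qbar oi c) - f qbar by rewrite subr_gt0.
    have := cvgr_gt _ (cvgB (upd_cvg oi c IH cQ) (sweep_fcvg i (ltnW iI))) _ d0.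
    by move=> gap; near=> k; rewrite -subr_gt0; near: k; exact: gap.
  (* Strictness puts the value at a level between the old and new coordinates below the larger
     endpoint value, which is the old one because updates do not increase [f]. *)
  have level k c : f (sweep (phi k) i) < f (upd (sweep (phi k) oi) oi c) ->
      (qs (phi k) oi 0 < c -> qs (phi k).+1 oi 0 < c) /\
      (c < qs (phi k) oi 0 -> c < qs (phi k).+1 oi 0).
    move=> fc; have fle := sweep_noninc (phi k) iI.
    have zQ := sweepQ (phi k) oi.
    have neq : qs (phi k).+1 oi 0 != c.
      by apply/eqP => yc; move: fc; rewrite -yc -zE ltNge fle.
    have {}fc : ~~ (f (upd (sweep (phi k) oi) oi c) <
        Num.max (f (sweep (phi k) i)) (f (sweep (phi k) i.+1))).
      by rewrite max_l// -leNgt ltW.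
    have zi : f (sweep (phi k) i) = f (upd (sweep (phi k) oi) oi (qs (phi k) oi 0)).
      by rewrite -sweep_id.
    split=> xc; rewrite ltNge; apply/negP;
      rewrite le_eqVlt ?(eq_sym c) (negPf neq)/= => cy; move/negP: fc; apply.
      rewrite zE zi.
      by apply: f_strict => //; exact: qsQ.
    rewrite maxC zE zi.
    by apply: f_strict => //; exact: qsQ.
  apply/cvgrPdist_lt => e e0.
  have qQ := qbarQ oi.
  have lower : \forall k \near \oo, qbar oi 0 - e < qs (phi k).+1 oi 0.
    have s1 : \forall k \near \oo,
        f (sweep (phi k) i) < f (upd (sweep (phi k) oi) oi (qbar oi 0 - e)).
      by apply: separated; [lra|rewrite lt_eqF//; lra].
    have s2 : \forall k \near \oo, qbar oi 0 - e < qs (phi k) oi 0.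
      by apply: (cvgr_gt _ xcvg); lra.
    by near=> k; apply: (level k _ _).2; near: k.
  have upper : \forall k \near \oo, qs (phi k).+1 oi 0 < qbar oi 0 + e.
    (* A level above the capacity cannot be tested, but then the capacity itself gives the bound. *)
    have [cQ|cQ] := leP (qbar oi 0 + e) (Q oi 0); last first.
      by apply: nearW => k; exact: le_lt_trans (qsQ _ _) cQ.
    have s1 : \forall k \near \oo,
        f (sweep (phi k) i) < f (upd (sweep (phi k) oi) oi (qbar oi 0 + e)).
      by apply: separated; [lra|rewrite gt_eqF//; lra].
    have s2 : \forall k \near \oo, qs (phi k) oi 0 < qbar oi 0 + e.
      by apply: (cvgr_lt _ xcvg); lra.
    by near=> k; apply: (level k _ _).1; near: k.
  near=> k; rewrite ltr_norml; apply/andP; split.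
    by rewrite ltrBrDl -ltrBrDr opprK; near: k.
  by rewrite ltrBlDr -ltrBlDl; near: k.
by move=> i x; apply: coord_min; exact: sweep_cvg (ltnW (ltn_ord i)).
Unshelve. all: by end_near. Qed.

End Convergence.
End Descent.

(** * The second-stage cost as a function of the interchange *)

(** Only points below [Q] are tested, so the notion is one-sided at the boundary. A subgradient
    inequality together with an upper error of order [e ^+ 2] amounts to differentiability relative
    to this orthant. *)
Definition tangent {R : realType} {I : nat} (Q : 'cV[R]_I) (f : 'cV[R]_I -> R)
    (q s : 'cV[R]_I) : Prop :=
  (forall p, lecv p Q -> f q + \sum_i s i 0 * (p i 0 - q i 0) <= f p) /\
  exists c, \forall e \near 0^'+, forall p, lecv p Q ->
    (forall i, `|p i 0 - q i 0| <= e) ->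
    f p <= f q + \sum_i s i 0 * (p i 0 - q i 0) + c * e ^+ 2.

Lemma tangent_sum (R : realType) (I : nat) (J : finType) (Q : 'cV[R]_I)
    (f : J -> 'cV[R]_I -> R) (q : 'cV[R]_I) (s : J -> 'cV[R]_I) :
  (forall j, tangent Q (f j) q (s j)) ->
  tangent Q (fun p => \sum_j f j p) q (\sum_j s j).
Proof.
move=> fs.
have dotE (p : 'cV[R]_I) : \sum_i (\sum_j s j) i 0 * (p i 0 - q i 0) =
    \sum_j \sum_i s j i 0 * (p i 0 - q i 0).
  rewrite exchange_big; apply: eq_bigr => i _.
  by rewrite summxE mulr_suml.
split=> [p pQ|].
  by rewrite dotE -big_split; apply: ler_sum => j _; exact: (fs j).1.
have /choice[c fc] j := (fs j).2.
exists (\sum_j c j).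
have {}fc := filter_forall _ fc.
near=> e => p pQ pe.
rewrite dotE mulr_suml -!big_split; apply: ler_sum => j _.
by move: p pQ pe; move: j; near: e; exact: fc.
Unshelve. all: by end_near. Qed.

Section Stage2.
Context {R : realType} {dT : measure_display} {T : measurableType dT} {N I : nat}.
Variables (S : system R T N I) (Q : 'cV[R]_I).
Hypothesis Hpos : forall n, posdef (H S n).
Hypothesis nondeg : forall n (q : 'cV[R]_I) (w : T), lecv q Q ->
     (exists g, feasible (qarea S n q) (dload S n w) g) /\
     primal_nondegenerate (qarea S n q) (dload S n w)
       (gstar (qarea S n q) (dload S n w)) /\
     dual_nondegenerate (qarea S n q) (dload S n w)
       (gstar (qarea S n q) (dload S n w)).

Let sgn (n : 'I_N) (i : 'I_I) : R :=
  if orig S i == n then 1 else if dest S i == n then - 1 else 0.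

Let qareaE n q i : qarea S n q i 0 = sgn n i * q i 0.
Proof. by rewrite mxE /sgn; do 2?case: ifP => _; rewrite ?mul1r ?mulN1r ?mul0r. Qed.

Let normr_sgn_le1 n i : `|sgn n i| <= 1.
Proof. by rewrite /sgn; do 2?case: ifP => _; rewrite ?normrN ?normr1 ?normr0. Qed.

(** The slope is the price with the signs of the outbound flows. The lower bound is
    [cost_ge_tangent] at the optimum for [p]; the upper bound compares that optimum with the
    feasible candidate [g + G *m h]. *)
Lemma stage2_tangent n w q : lecv q Q -> exists s,
  tangent Q (fun p => stage2_cost S n p w) q s /\
  forall p, lecv p Q -> \sum_i qarea S n p i 0 != \sum_i qarea S n q i 0 ->
    stage2_cost S n q w + \sum_i s i 0 * (p i 0 - q i 0) < stage2_cost S n p w.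
Proof.
move=> qQ.
have [gF [licq [lam [mu [nu [stat [mu0 [nu0 [muA nuA]]]]]]]]] := nondeg n w qQ.
have gstar_opt p : lecv p Q ->
    optimal (qarea S n p) (dload S n w) (gstar (qarea S n p) (dload S n w)).
  by move=> pQ; apply: gstar_optimal => //; have [] := nondeg n w pQ.
have [Hsym Hgt0] := Hpos n.
set g := gstar _ _ in licq stat muA nuA.
have [{}gF gmin] := gstar_opt q qQ; rewrite -/g in gF gmin.
have sE (p : 'cV[R]_I) : \sum_i price lam mu i 0 * (qarea S n p - qarea S n q) i 0 =
   \sum_i (\col_i (sgn n i * price lam mu i 0)) i 0 * (p i 0 - q i 0).
  by apply: eq_bigr => i _; rewrite mx_addE mx_oppE !qareaE [X in _ = X * _]mxE; ring.
exists (\col_i (sgn n i * price lam mu i 0)).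
pose gs p := gstar (qarea S n p) (dload S n w).
have lower p : lecv p Q ->
    stage2_cost S n q w
    + \sum_i (\col_i (sgn n i * price lam mu i 0)) i 0 * (p i 0 - q i 0)
    + 2^-1 * ((gs p - g)^T *m H S n *m (gs p - g)) 0 0 <= stage2_cost S n p w.
  move=> pQ; rewrite -sE.
  exact (cost_ge_tangent Hsym gF stat mu0 nu0 muA nuA (gstar_opt p pQ).1).
split; [split|].
- move=> p pQ; apply: le_trans (lower p pQ); rewrite lerDl mulr_ge0//.
  set x := _ - _; have [->|/Hgt0/ltW//] := eqVneq x 0.
  by rewrite mulmx0 mxE.
- have [G Gh] := primal_nondegenerate_solve licq.
  pose M := G^T *m H S n *m G.
  exists (2^-1 * \sum_i \sum_j `|M i j|).
  have e_gt0 : \forall e \near 0^'+, (0 : R) < e by exact: nbhs_right_gt.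
  have near_feas := feasible_near gF Gh.
  near=> e => p pQ pe.
  have e0 : 0 < e by near: e.
  pose h := qarea S n p - qarea S n q.
  have he i : `|h i 0| <= e.
    rewrite mx_addE mx_oppE !qareaE -mulrBr normrM (le_trans _ (pe i))//.
    by rewrite ler_piMl ?normr_sgn_le1.
  have := (gstar_opt p pQ).2 _ (_ : feasible _ _ (g + G *m h)).
  rewrite /stage2_cost => /(_ _)/le_trans; apply.
    rewrite -[X in feasible X](subrKC (qarea S n q)) -/h.
    by move: h he; near: e; exact: near_feas.
  have [Gsum GA GE] := Gh h.
  rewrite (cost_tangent Hsym stat mu0 nu0 muA nuA Gsum GA GE) sE lerD2l -mulrA.
  by rewrite ler_pM2l ?invr_gt0//; apply: le_quadratic_form => //; exact: ltW.
(* A different net export forces a different total generation, hence a different dispatch and a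
   positive quadratic remainder. *)
- move=> p pQ pq; apply: lt_le_trans (lower p pQ); rewrite ltrDl mulr_gt0 ?invr_gt0//.
  apply: Hgt0; rewrite subr_eq0; apply: contraNneq pq => gg.
  have := feasible_sum (gstar_opt p pQ).1; rewrite -/(gs p) gg (feasible_sum gF).
  by move=> /addrI ->.
Unshelve. all: by end_near. Qed.

Definition total_cost (w : T) (q : 'cV[R]_I) : R := \sum_n stage2_cost S n q w.

(** Changing flow [i] alone changes the net export of its origin area, whose inequality is therefore
    strict; the other areas contribute weak inequalities. *)
Lemma total_cost_tangent w q : lecv q Q -> exists s,
  tangent Q (total_cost w) q s /\
  forall i x, x <= Q i 0 -> x != q i 0 ->
    total_cost w q + s i 0 * (x - q i 0) < total_cost w (upd q i x).
Proof.
move=> qQ; have /choice[s ss] n := stage2_tangent n w qQ.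
exists (\sum_n s n); have tan : tangent Q (total_cost w) q (\sum_n s n).
  by apply: tangent_sum => n; exact: (ss n).1.
split=> // i x xQ xq.
have dotE (t : 'cV[R]_I) : \sum_j t j 0 * (upd q i x j 0 - q j 0) = t i 0 * (x - q i 0).
  rewrite (bigD1 i)//= updE big1 ?addr0// => j ji.
  by rewrite updNE// subrr mulr0.
rewrite summxE mulr_suml /total_cost -big_split/=.
have uQ := lecv_upd qQ xQ.
rewrite [ltLHS](bigD1 (orig S i))//= [ltRHS](bigD1 (orig S i))//=.
apply: ltr_leD; last first.
  by apply: ler_sum => n _; rewrite -dotE; exact: (ss n).1.1.
rewrite -dotE; apply: (ss (orig S i)).2 => //.
rewrite (bigD1 i)//= [X in _ != X](bigD1 i)//= !qareaE /sgn eqxx !mul1r updE.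
rewrite (eq_bigr (fun j => qarea S (orig S i) q j 0)) => [|j ji]; last first.
  by rewrite !qareaE updNE.
by rewrite (inj_eq (addIr _)).
Qed.

Lemma total_cost_lower_bound : exists c, forall w q, c <= total_cost w q.
Proof.
have /choice[c cn] n := cost_lower_bound (Hpos n).
by exists (\sum_n c n) => w q; apply: ler_sum => n _; exact: cn.
Qed.

End Stage2.

(** * Expected cost *)

Section RealIntegral.
Context {R : realType} {d : measure_display} {T : measurableType d}.
Variable P : probability T R.
Implicit Types f g : T -> R.

Definition rintegrable f := P.-integrable setT (EFin \o f).

Lemma rintegrableD f g :
  rintegrable f -> rintegrable g -> rintegrable (fun w => f w + g w).
Proof. by move=> fi gi; exact: (integrableD measurableT fi gi). Qed.

Lemma rintegrableZ (a : R) f : rintegrable f -> rintegrable (fun w => a * f w).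
Proof. by move=> fi; exact: (integrableZl measurableT a fi). Qed.

Lemma rintegrableB f g :
  rintegrable f -> rintegrable g -> rintegrable (fun w => f w - g w).
Proof. by move=> fi gi; exact: (integrableB measurableT fi gi). Qed.

Lemma rintegrable_sum (J : finType) (f : J -> T -> R) :
  (forall j, rintegrable (f j)) -> rintegrable (fun w => \sum_j f j w).
Proof.
move=> fi; rewrite /rintegrable.
rewrite (_ : _ \o _ = fun w => (\sum_j (EFin \o f j) w)%E); last first.
  by apply/funext => w /=; rewrite sumEFin.
by apply: (integrable_sum measurableT) => j _; exact: fi.
Qed.

Lemma Rintegral_sum (J : finType) (f : J -> T -> R) :
  (forall j, rintegrable (f j)) ->
  \int[P]_w (\sum_j f j w) = \sum_j \int[P]_w f j w.
Proof.
move=> fi; rewrite /Rintegral.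
under eq_integral do rewrite -sumEFin.
rewrite (integral_sum measurableT fi) -sum_fine// => j _.
exact: (integrable_fin_num measurableT (fi j)).
Qed.

Lemma measurable_rintegrable f : rintegrable f -> measurable_fun setT f.
Proof. by move=> /integrableP[/measurable_EFinP]. Qed.

Lemma rintegrable_dominated f g : measurable_fun setT f ->
  (forall w, `|f w| <= g w) -> rintegrable g -> rintegrable f.
Proof.
move=> mf fg; apply: le_integrable => //; first exact/measurable_EFinP.
by move=> w _ /=; rewrite lee_fin (le_trans (fg w))// ler_norm.
Qed.

Lemma rintegrable_max f g : rintegrable f -> rintegrable g ->
  rintegrable (fun w => Num.max (f w) (g w)).
Proof.
move=> fi gi; apply: (rintegrable_dominated (g := fun w => `|f w| + `|g w|)).
- by apply: measurable_maxr; exact: measurable_rintegrable.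
- by move=> w /=; rewrite /Order.max; case: ifP => _; rewrite ?lerDl ?lerDr.
- by apply: rintegrableD; exact: integrable_norm.
Qed.

(** A zero integral would make [f] vanish almost everywhere, so the whole space would lie in a null
    set. *)
Lemma Rintegral_gt0 f : rintegrable f -> (forall w, 0 < f w) ->
  0 < \int[P]_w f w.
Proof.
move=> fi f0.
have ge0 : (0 <= \int[P]_w (f w)%:E)%E.
  by apply: integral_ge0 => w _; rewrite lee_fin ltW.
rewrite lt_neqAle; apply/andP; split; last exact: fine_ge0.
apply/eqP => /esym int0.
have : ae_eq P setT (EFin \o f) (cst 0%E).
  apply/(ae_eq_integral_abs P measurableT).
    exact/measurable_EFinP/measurable_rintegrable.
  rewrite (_ : (fun _ => _) = EFin \o f); last first.
    by apply/funext => w /=; rewrite ger0_norm// ltW.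
  by rewrite -(fineK (integrable_fin_num measurableT fi)) [fine _]int0.
move=> [A [mA PA0 nA]].
have : (P setT <= P A)%E.
  apply: le_measure; rewrite ?inE// => w _; apply: nA => /= /(_ Logic.I) /eqP.
  by rewrite eqe gt_eqF.
by rewrite PA0 probability_setT lee_fin ler10.
Qed.

Lemma Rintegral_dominated_cvg (f_ : nat -> T -> R) f g :
  (forall k, rintegrable (f_ k)) -> rintegrable f -> rintegrable g ->
  (forall w, f_ ^~ w @ \oo --> f w) -> (forall k w, `|f_ k w| <= g w) ->
  (fun k => \int[P]_w f_ k w) @ \oo --> \int[P]_w f w.
Proof.
move=> f_i fi gi f_f f_g.
have [||||_ _] := @dominated_convergence _ _ _ P setT measurableT
  (fun k => EFin \o f_ k) (EFin \o f) (EFin \o g) _ _ _ gi.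
- by move=> k; exact/measurable_EFinP/measurable_rintegrable.
- exact/measurable_EFinP/measurable_rintegrable.
- by apply: aeW => w _; apply: cvg_EFin; [exact: nearW|exact: f_f].
- by apply: aeW => w k _; rewrite lee_fin.
rewrite -(fineK (integrable_fin_num measurableT fi)).
by move=> /fine_cvg.
Qed.

End RealIntegral.

(** * Continuity, difference quotients and convexity from tangents *)

Section Tangent.
Context {R : realType} {I : nat}.
Variables (Q : 'cV[R]_I) (f : 'cV[R]_I -> R).
Implicit Types (p q s : 'cV[R]_I).

Lemma tangent_eps q s : tangent Q f q s -> exists c r, [/\ 0 <= c, 0 < r &
  forall e p, 0 < e -> e < r -> lecv p Q -> (forall i, `|p i 0 - q i 0| <= e) ->
    f p <= f q + \sum_i s i 0 * (p i 0 - q i 0) + c * e ^+ 2].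
Proof.
move=> [_ [c /nbhs_right0P/nbhs_ballP[r /= r0 fr]]].
exists `|c|, r; split=> // e p e0 er pQ pe.
apply: (@le_trans _ _ (f q + \sum_i s i 0 * (p i 0 - q i 0) + c * e ^+ 2)).
  by have := fr e; rewrite /ball/= sub0r normrN gtr0_norm// add0r; apply.
by rewrite lerD2l ler_wpM2r ?ler_norm// exprn_ge0// ltW.
Qed.

Lemma tangent_cvg (p : nat -> 'cV[R]_I) q s : tangent Q f q s ->
  (forall k, lecv (p k) Q) -> (forall i, (fun k => p k i 0) @ \oo --> q i 0) ->
  (fun k => f (p k)) @ \oo --> f q.
Proof.
move=> tan pQ pq; have [c [r [c0 r0 upper]]] := tangent_eps tan.
have dot_cvg : (fun k => \sum_i s i 0 * (p k i 0 - q i 0)) @ \oo --> (0 : R).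
  have : (fun k => \sum_i s i 0 * (p k i 0 - q i 0)) @ \oo -->
      \sum_i s i 0 * (q i 0 - q i 0).
    by apply: cvgr_sum => i; exact: cvgMl_tmp (cvgB (pq i) (cvg_cst (q i 0))).
  by rewrite [X in _ --> X]big1// => i _; rewrite subrr mulr0.
apply/cvgrPdist_le => eps eps0.
(* The three bounds keep [e] in the range of the upper estimate, give [e ^+ 2 <= e], and then make
   [c * e ^+ 2] at most [eps / 2]. *)
pose e := Num.min (r / 2) (Num.min 1 (eps / 2 / (c + 1))).
have c1 : 0 < c + 1 by rewrite ltr_wpDl.
have e0 : 0 < e by rewrite !lt_min ltr01 !divr_gt0.
have er : e < r by rewrite gt_min; apply/orP; left; lra.
have ce : c * e ^+ 2 <= eps / 2.
  have e1 : e <= 1 by rewrite !ge_min lexx orbT.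
  have : e <= eps / 2 / (c + 1) by rewrite !ge_min lexx !orbT.
  rewrite ler_pdivlMr ?ltr_wpDl//; nra.
have close : \forall k \near \oo, forall i, `|p k i 0 - q i 0| <= e.
  apply: filter_forall => i; move/cvgrPdistC_le : (pq i); exact.
have small : \forall k \near \oo, `|\sum_i s i 0 * (p k i 0 - q i 0)| <= eps / 2.
  have e20 : 0 < eps / 2 by lra.
  by move/cvgr0Pnorm_le : dot_cvg; apply.
near=> k.
have near_q : forall i, `|p k i 0 - q i 0| <= e by near: k.
have up := upper e (p k) e0 er (pQ k) near_q.
have low := tan.1 (p k) (pQ k).
have : `|\sum_i s i 0 * (p k i 0 - q i 0)| <= eps / 2 by near: k.
rewrite !ler_norml => /andP[? ?].
by apply/andP; split; lra.
Unshelve. all: by end_near. Qed.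

Lemma tangent_coord q s i x : tangent Q f q s -> lecv q Q -> x <= Q i 0 ->
  f q + s i 0 * (x - q i 0) <= f (upd q i x).
Proof.
move=> [+ _] qQ xQ => /(_ _ (lecv_upd qQ xQ)).
rewrite (bigD1 i)//= updE big1 ?addr0// => j ji.
by rewrite updNE// subrr mulr0.
Qed.

Lemma tangent_coord_cvg q s i h (t : nat -> R) : tangent Q f q s -> lecv q Q ->
  q i 0 + h <= Q i 0 -> (forall k, 0 < t k <= 1) -> t @ \oo --> (0 : R) ->
  (fun k => (t k)^-1 * (f (upd q i (q i 0 + t k * h)) - f q)) @ \oo --> s i 0 * h.
Proof.
move=> tan qQ hQ t01 t_cvg; have [c [r [c0 r0 upper]]] := tangent_eps tan.
(* Adding [1] keeps the radius [t k * b] positive even when [h] is zero. *)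
pose b := `|h| + 1.
have b0 : 0 < b by rewrite ltr_wpDl.
have tQ k : q i 0 + t k * h <= Q i 0.
  by have := qQ i; have /andP[? ?] := t01 k; have [h0|h0] := leP 0 h; nra.
apply: (@squeeze_cvgr _ _ _ _ (fun=> s i 0 * h) (fun k => s i 0 * h + c * b ^+ 2 * t k)).
- have small : \forall k \near \oo, t k < r / b.
    by apply: (cvgr_lt _ t_cvg); rewrite divr_gt0.
  near=> k; have /andP[t0 _] := t01 k.
  have tb0 : 0 < t k * b by rewrite mulr_gt0.
  have tbr : t k * b < r by rewrite -ltr_pdivlMr//; near: k.
  have close j : `|upd q i (q i 0 + t k * h) j 0 - q j 0| <= t k * b.
    have [->|ji] := eqVneq j i; last by rewrite updNE// subrr normr0 ltW.
    by rewrite updE addrAC subrr add0r normrM gtr0_norm// ler_pM2l// lerDl.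
  have up := upper _ _ tb0 tbr (lecv_upd qQ (tQ k)) close.
  have low := tangent_coord tan qQ (tQ k).
  have dotE : \sum_j s j 0 * (upd q i (q i 0 + t k * h) j 0 - q j 0) = s i 0 * (t k * h).
    rewrite (bigD1 i)//= updE big1 ?addr0 => [|j ji]; first by ring.
    by rewrite updNE// subrr mulr0.
  rewrite ler_pdivlMl// ler_pdivrMl//; move: up low; rewrite dotE.
  by move=> up low; apply/andP; split; lra.
- exact: cvg_cst.
- rewrite -[X in _ --> X]addr0 -[X in _ + X](mulr0 (c * b ^+ 2)).
  by apply: cvgD; [exact: cvg_cst|exact: cvgMl_tmp].
Unshelve. all: by end_near. Qed.

Hypothesis subdiff : forall q, lecv q Q -> exists s, tangent Q f q s.

(** The subgradient at the intermediate point bounds both endpoint values; the weights [1 - t] and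
    [t] cancel its slope. *)
Lemma tangent_coord_convex q i h t : lecv q Q -> q i 0 + h <= Q i 0 ->
  0 <= t -> t <= 1 ->
  f (upd q i (q i 0 + t * h)) - f q <= t * (f (upd q i (q i 0 + h)) - f q).
Proof.
move=> qQ hQ t0 t1.
have tQ : q i 0 + t * h <= Q i 0.
  by have := qQ i; have [h0|h0] := leP 0 h; nra.
have [s tan] := subdiff (lecv_upd qQ tQ).
have := tangent_coord tan (lecv_upd qQ tQ) hQ.
have := tangent_coord tan (lecv_upd qQ tQ) (qQ i).
rewrite !upd_upd upd_id !updE; nra.
Qed.

(* [p] lies in the simplex with apex [Q] and vertices [Q - M e_i]. *)
Lemma tangent_upper_bound p M : lecv p Q -> 0 < M ->
  \sum_i (Q i 0 - p i 0) <= M ->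
  f p <= `|f Q| + \sum_i `|f (upd Q i (Q i 0 - M))|.
Proof.
move=> pQ M0 sM; have [s [sub _]] := subdiff pQ.
have QQ : lecv Q Q by [].
have vQ i : lecv (upd Q i (Q i 0 - M)) Q by apply: lecv_upd => //; lra.
have apex := sub Q QQ.
pose sg := \sum_i s i 0 * (Q i 0 - p i 0).
have vertex i : f p + sg - M * s i 0 <= f (upd Q i (Q i 0 - M)).
  apply: le_trans (sub _ (vQ i)); rewrite /sg.
  rewrite (bigD1 i)//= [X in _ <= _ + X](bigD1 i)//= updE.
  rewrite [X in _ <= _ + (_ + X)](eq_bigr (fun j => s j 0 * (Q j 0 - p j 0)));
    first by lra.
  move=> j ji.
  by rewrite updNE.
(* These are the barycentric weights of [p] at the vertices, the apex receiving the remainder.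
   Averaging the subgradient inequalities with them cancels the linear terms. *)
pose th i := (Q i 0 - p i 0) / M.
have th0 i : 0 <= th i by rewrite divr_ge0 ?subr_ge0// ltW.
have th1 : \sum_i th i <= 1 by rewrite -mulr_suml ler_pdivrMr// mul1r.
have thi i : th i <= 1.
  apply: le_trans th1; rewrite (bigD1 i)//= lerDl; exact: sumr_ge0.
have sgE : \sum_i th i * (M * s i 0) = sg.
  apply: eq_bigr => i _; rewrite /th; field; exact: lt0r_neq0.
have : (1 - \sum_i th i) * (f p + sg) + \sum_i th i * (f p + sg - M * s i 0) = f p.
  under [X in _ + X = _]eq_bigr do rewrite mulrBr.
  by rewrite sumrB sgE -[X in _ + (X - _)]mulr_suml; ring.
move=> <-; apply: lerD.
  have s0 : 0 <= \sum_i th i by exact: sumr_ge0.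
  have := ler_norm (f Q); have := normr_ge0 (f Q); move: apex; rewrite -/sg; nra.
apply: ler_sum => i _; have := vertex i; have := th0 i; have := thi i.
have := ler_norm (f (upd Q i (Q i 0 - M))).
by have := normr_ge0 (f (upd Q i (Q i 0 - M))); nra.
Qed.

End Tangent.

(** * Continuity, strict quasiconvexity and optimality for the expectation *)

Section Expectation.
Context {R : realType} {d : measure_display} {T : measurableType d} {I : nat}.
Variables (P : probability T R) (Q : 'cV[R]_I) (V : T -> 'cV[R]_I -> R).
Hypothesis V_int : forall q, lecv q Q -> rintegrable P (V^~ q).
Hypothesis V_tan : forall w q, lecv q Q -> exists s, tangent Q (V w) q s /\
  forall i x, x <= Q i 0 -> x != q i 0 ->
    V w q + s i 0 * (x - q i 0) < V w (upd q i x).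
Hypothesis V_lb : exists c, forall w q, c <= V w q.

Let EV q := \int[P]_w V w q.

Let V_sub w q : lecv q Q -> exists s, tangent Q (V w) q s.
Proof. by move=> /(V_tan w)[s []]; exists s. Qed.

Lemma expectation_cont (p : nat -> 'cV[R]_I) q :
  (forall k, lecv (p k) Q) -> lecv q Q ->
  (forall i, (fun k => p k i 0) @ \oo --> q i 0) ->
  (fun k => EV (p k)) @ \oo --> EV q.
Proof.
move=> pQ qQ pq; have [c cV] := V_lb.
have gap_cvg : (fun k => \sum_i (Q i 0 - p k i 0)) @ \oo --> \sum_i (Q i 0 - q i 0).
  by apply: cvgr_sum => i; apply: cvgB; [exact: cvg_cst|exact: pq].
(* A single [M] places all the [p k] in one simplex, so the vertex values give an integrable bound
   independent of [k]. *)
have [M M0 pM] : exists2 M, 0 < M & forall k, \sum_i (Q i 0 - p k i 0) <= M.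
  have [M [_ Mb]] := cvg_seq_bounded (cvgP _ gap_cvg).
  exists (`|M| + 1) => [|k]; first by rewrite ltr_wpDl.
  apply: le_trans (ler_norm _) _; apply: (Mb (`|M| + 1)) => //.
  by rewrite ltr_pwDr// ler_norm.
apply: (@Rintegral_dominated_cvg _ _ _ P _ _
  (fun w => `|c| + (`|V w Q| + \sum_i `|V w (upd Q i (Q i 0 - M))|))).
- by move=> k; exact: V_int.
- exact: V_int.
- apply: rintegrableD; first exact: finite_measure_integrable_cst.
  apply: rintegrableD; first by apply: integrable_norm; exact: V_int.
  apply: rintegrable_sum => i; apply: integrable_norm; apply: V_int.
  by apply: lecv_upd => //; lra.
- move=> w; have [s tan] := V_sub w qQ; exact: tangent_cvg tan pQ pq.
- move=> k w; rewrite ler_norml; apply/andP; split.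
    apply: le_trans (cV w (p k)).
    rewrite lerNl (le_trans (ler_norm _))// normrN lerDl addr_ge0//.
    exact: sumr_ge0.
  apply: le_trans (tangent_upper_bound (V_sub w) (pQ k) M0 (pM k)) _.
  by rewrite lerDr.
Qed.

(** Weighting the strict tangent inequalities at [c] by [y - c] and [c - x] cancels the slope. Only
    values of [V] remain to be integrated, and the combination is positive for every realization. *)
Lemma expectation_strict z i x c y : lecv z Q -> x < c -> c < y -> y <= Q i 0 ->
  EV (upd z i c) < Num.max (EV (upd z i x)) (EV (upd z i y)).
Proof.
move=> zQ xc cy yQ.
have cQ : c <= Q i 0 by lra.
have xQ : x <= Q i 0 by lra.
have zxi := V_int (lecv_upd zQ xQ).
have zyi := V_int (lecv_upd zQ yQ).
have zci := V_int (lecv_upd zQ cQ).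
have /Rintegral_gt0 : rintegrable P (fun w => (y - c) * V w (upd z i x)
    + (c - x) * V w (upd z i y) - (y - x) * V w (upd z i c)).
  by apply: rintegrableB; [apply: rintegrableD|]; exact: rintegrableZ.
have pos w : 0 < (y - c) * V w (upd z i x)
    + (c - x) * V w (upd z i y) - (y - x) * V w (upd z i c).
  have [s [_ strict]] := V_tan w (lecv_upd zQ cQ).
  have xc' : x != c by rewrite lt_eqF.
  have yc' : y != c by rewrite gt_eqF.
  have := strict i x xQ; have := strict i y yQ; rewrite !upd_upd updE.
  by move=> /(_ yc') hy /(_ xc') hx; nra.
move=> /(_ pos).
rewrite RintegralB//; [|by apply: rintegrableD; exact: rintegrableZ|exact: rintegrableZ].
rewrite RintegralD//; [|exact: rintegrableZ..].
rewrite !RintegralZl// -/(EV _) -/(EV _) -/(EV _) => lt0.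
rewrite ltNge ge_max; apply/negP => /andP[? ?]; nra.
Qed.

(** The quotients [D k] tend pointwise to the slope term [sg], which is at most [W]. Hence
    [Num.max (D k) W] tends to [W], while its integral is at least that of [D k], which is
    nonnegative. Passing through the maximum avoids integrating [sg], a term built from chosen
    subgradients. *)
Lemma expectation_coord_min q : lecv q Q ->
  (forall i x, x <= Q i 0 -> EV q <= EV (upd q i x)) ->
  forall q', lecv q' Q -> EV q <= EV q'.
Proof.
move=> qQ q_min q' q'Q.
pose h i := q' i 0 - q i 0.
have hQ i : q i 0 + h i <= Q i 0 by rewrite /h subrKC.
(* The sequence starts at [1], so [D 0] collects the full-step differences and, by convexity, bounds
   every [D k] from above. *)
pose t k : R := harmonic k.
have t0 k : 0 < t k by exact: harmonic_gt0.
have t1 k : t k <= 1 by rewrite invf_le1// ler1n.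
have t_first : t 0%N = 1 by rewrite /t /harmonic/= invr1.
have t_cvg : t @ \oo --> (0 : R) by exact: cvg_harmonic.
have t01 k : 0 < t k <= 1 by rewrite t0 t1.
clearbody t.
have tQ k i : q i 0 + t k * h i <= Q i 0.
  by have := qQ i; have := t0 k; have := t1 k; have := hQ i;
     have [h0|h0] := leP 0 (h i); nra.
pose u k i := upd q i (q i 0 + t k * h i).
have uQ k i : lecv (u k i) Q by exact: lecv_upd.
pose D k w := \sum_i (t k)^-1 * (V w (u k i) - V w q).
pose W w := V w q' - V w q.
have Di k : rintegrable P (D k).
  apply: rintegrable_sum => i; apply: rintegrableZ.
  by apply: rintegrableB; exact: V_int.
have Wi : rintegrable P W by apply: rintegrableB; exact: V_int.
have intD k : 0 <= \int[P]_w D k w.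
  rewrite Rintegral_sum => [|i]; last first.
    by apply: rintegrableZ; apply: rintegrableB; exact: V_int.
  apply: sumr_ge0 => i _; rewrite RintegralZl//; last first.
    by apply: rintegrableB; exact: V_int.
  rewrite RintegralB//; [|exact: V_int..].
  apply: mulr_ge0; first by rewrite invr_ge0 ltW.
  by rewrite subr_ge0; exact: q_min.
have D_le k w : D k w <= D 0%N w.
  apply: ler_sum => i _.
  rewrite /u t_first invr1 !mul1r ler_pdivrMl//.
  exact: (tangent_coord_convex (V_sub w)) (ltW (t0 k)) (t1 k).
have max_cvg : (fun k => \int[P]_w Num.max (D k w) (W w)) @ \oo --> \int[P]_w W w.
  apply: (@Rintegral_dominated_cvg _ _ _ P _ _ (fun w => `|D 0%N w| + `|W w|)).
  - by move=> k; exact: rintegrable_max.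
  - by [].
  - apply: rintegrableD; first exact: integrable_norm (Di 0%N).
    exact: integrable_norm Wi.
  - move=> w; have [s tan] := V_sub w qQ.
    pose sg := \sum_i s i 0 * h i.
    have sgW : sg <= W w by rewrite /W lerBrDl; exact: tan.1.
    have Dsg k : sg <= D k w.
      apply: ler_sum => i _; rewrite ler_pdivlMl// lerBrDl.
      have := tangent_coord tan qQ (tQ k i); rewrite -/(u k i).
      by rewrite addrAC subrr add0r mulrCA.
    have D_cvg : (fun k => D k w) @ \oo --> sg.
      by apply: cvgr_sum => i; exact: tangent_coord_cvg tan qQ (hQ i) t01 t_cvg.
    (* Both [D k w] and [W w] are at least [sg], so neither exceeds [W w + (D k w - sg)]. *)
    apply: (@squeeze_cvgr _ _ _ _ (cst (W w)) (fun k => W w + (D k w - sg))).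
    + apply: nearW => k; have := Dsg k.
      by rewrite le_max lexx orbT/= ge_max => ?; apply/andP; split; lra.
    + exact: cvg_cst.
    + rewrite -[X in _ --> X]addr0 -[X in _ + X](subrr sg).
      apply: cvgD; first exact: cvg_cst.
      by apply: cvgB => //; exact: cvg_cst.
  - move=> k w; have := D_le k w.
    have := ler_norm (D 0%N w); have := normr_ge0 (D 0%N w).
    have := ler_norm (W w); have := ler_norm (- W w); rewrite normrN.
    move=> ? ? ? ? ?; rewrite ler_norml /Order.max.
    by case: ltP => ?; apply/andP; split; lra.
have : 0 <= \int[P]_w W w.
  apply: (ler_cvg_to (cvg_cst 0) max_cvg); apply: nearW => k.
  apply: le_trans (intD k) _; apply: le_Rintegral => //.
  - exact: Di.
  - exact: (rintegrable_max (Di k) Wi).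
  - by move=> w _; rewrite le_max lexx.
by rewrite RintegralB//; [rewrite subr_ge0|exact: V_int..].
Qed.

End Expectation.

(** * Optimality of the limit points of the cyclic updates *)

Lemma Cbar_expectation (R : realType) (dT : measure_display) (T : measurableType dT)
    (P : probability T R) (N I : nat) (S : system R T N I) (q : 'cV[R]_I) :
  (forall n, rintegrable P (fun w => stage2_cost S n q w)) ->
  Cbar S P q = \int[P]_w total_cost S w q.
Proof. by move=> Si; rewrite Rintegral_sum. Qed.

Theorem theorem2 (R : realType) (dT : measure_display) (T : measurableType dT)
  (P : probability T R) (N I : nat) (S : system R T N I)
  (Q : 'cV[R]_I) (qs : nat -> 'cV[R]_I) :
  (* standing assumption: H_n positive definite *)
  (forall n, posdef (H S n)) ->
  (* (i) feasibility and nondegeneracy of every second-stage problem *)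
  (forall n (q : 'cV[R]_I) (w : T), lecv q Q ->
     (exists g, feasible (qarea S n q) (dload S n w) g) /\
     primal_nondegenerate (qarea S n q) (dload S n w)
       (gstar (qarea S n q) (dload S n w)) /\
     dual_nondegenerate (qarea S n q) (dload S n w)
       (gstar (qarea S n q) (dload S n w))) ->
  (* (i) \bar C(q) finite for q <= Q: each expectation is finite *)
  (forall n (q : 'cV[R]_I), lecv q Q ->
     P.-integrable setT (fun w => (stage2_cost S n q w)%:E)) ->
  (* (ii) every one-dimensional minimization has a minimizer *)
  (forall (qk qk1 : 'cV[R]_I) (i : 'I_I), lecv qk Q -> lecv qk1 Q ->
     exists x, x <= Q i 0 /\
       forall y, y <= Q i 0 -> Cbar S P (mixvec qk qk1 i x) <= Cbar S P (mixvec qk qk1 i y)) ->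
  (* initial point *)
  lecv (qs 0%N) Q ->
  (* cyclic interface-by-interface update *)
  (forall (k : nat) (i : 'I_I), (0 < k)%N ->
     qs k i 0 <= Q i 0 /\
     forall x, x <= Q i 0 ->
       Cbar S P (mixvec (qs k) (qs k.-1) i (qs k i 0))
         <= Cbar S P (mixvec (qs k) (qs k.-1) i x)) ->
  forall qstar : 'cV[R]_I, seq_limit_point qs qstar ->
    lecv qstar Q /\
    forall q : 'cV[R]_I, lecv q Q -> Cbar S P qstar <= Cbar S P q.
Proof.
move=> Hpos nondeg Si _ qs0 qs_upd qstar qstar_lim.
have CbarE q : lecv q Q -> Cbar S P q = \int[P]_w total_cost S w q.
  by move=> qQ; apply: Cbar_expectation => n; exact: Si.
have V_int q : lecv q Q -> rintegrable P (fun w => total_cost S w q).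
  by move=> qQ; apply: rintegrable_sum => n; exact: Si.
have V_tan := total_cost_tangent Hpos nondeg.
have V_lb := total_cost_lower_bound Hpos.
have qsQ k : lecv (qs k) Q.
  by case: k => [//|k] i; have [] := qs_upd k.+1 i isT.
(* [CbarE] is available below [Q], so the mixed points must be placed there before the update rule
   is rewritten. *)
have mixQ k i x : x <= Q i 0 -> lecv (mixvec (qs k.+1) (qs k) i x) Q.
  by move=> xQ j; rewrite mxE; case: ifP => _; [|case: eqP => [->//|_]]; exact: qsQ.
have [] := @coordinate_descent_limit _ _ Q
  (fun q => \int[P]_w total_cost S w q) qs _ _ qsQ _ qstar qstar_lim.
- by move=> p q; exact: expectation_cont V_int V_tan V_lb p q.
- by move=> z i x c y; exact: expectation_strict V_int V_tan z i x c y.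
- move=> k i x xQ; have [_ /(_ x xQ)] := qs_upd k.+1 i isT.
  have newQ := mixQ k i _ (qsQ k.+1 i); have xmQ := mixQ k i x xQ.
  by rewrite /= (CbarE _ newQ) (CbarE _ xmQ).
move=> qstarQ coord_min; split; [exact: qstarQ|move=> q qQ].
rewrite (CbarE _ qstarQ) (CbarE _ qQ).
exact: (expectation_coord_min V_int V_tan).
Qed.
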